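(* Let $(X,\mathsf d,\mathfrak m)$ be a metric measure space with gauge function $\mathsf G$, satisfying $\mathsf{MCP}(\beta)$ for a distortion coefficient $\beta$ (with parameter $N$). Then any $\mathsf G$-bounded Borel subset $S\subseteq\mathrm{supp}\,\mathfrak m$ satisfies the following: for all $t\in(0,1)$ there exists $C_{S,t}>0$ such that $$\mathfrak m(B_r(x_0)\cap S)\le C_{S,t}\cdot\mathfrak m(B_{tr}(x_0)),\qquad\forall\,r\ge0,\ \forall\,x_0\in S.$$ The constant $C_{S,t}$ can be estimated in terms of $\beta$ and $\mathrm{diam}_{\mathsf G}(S)$: $$\frac1{C_{S,t}}=\inf\{\beta_t(\theta):\theta\in[0,\mathrm{diam}_{\mathsf G}(S)]\}\in(0,t^N].$$
   Context: A metric measure space is a complete separable metric space $(X,\mathsf d)$ with a non-negative Borel measure $\mathfrak m$ finite on bounded sets; a gauge function is a Borel map $\mathsf G:X\times X\to[0,+\infty]$. $B_r(x)$ is the open ball. **Distortion coefficient.** Given $\mathsf s:[0,\infty)\to\mathbb R$ continuous with $\mathsf s(\theta)=c\theta^N+o(\theta^N)$ as $\theta\to0$ for some $c>0$, $N\in[1,\infty)$, let $\mathcal D=\inf\{\theta>0:\mathsf s(\theta)=0\}$. For $t\in[0,1]$, $\theta\in[0,+\infty]$: $\beta_t(0)=t^N$; $\beta_t(\theta)=\mathsf s(t\theta)/\mathsf s(\theta)$ if $0<\theta<\mathcal D$; $\beta_t(\theta)=\liminf_{\phi\to\mathcal D^-}\mathsf s(t\phi)/\mathsf s(\phi)$ if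 $\theta\ge\mathcal D$. **$\mathsf G$-diameter** of a non-empty set: $\mathrm{diam}_{\mathsf G}(S)=\sup_{x\in S}\big(\mathfrak m\text{-}\mathrm{ess\,sup}_{y\in S,\,y\ne x}\mathsf G(x,y)\big)$; $S$ is $\mathsf G$-bounded if it is non-empty and has finite $\mathsf G$-diameter. **$\mathsf{MCP}(\beta)$.** $W_2$ is the quadratic Wasserstein distance. $\mathrm{Ent}(\mu|\mathfrak m)=\int\rho\log\rho\,d\mathfrak m$ if $\mu=\rho\mathfrak m$ has finite second moment and $\rho\log\rho\in L^1$, $+\infty$ otherwise; $\mathrm U_n(\mu|\mathfrak m)=\exp(-\mathrm{Ent}(\mu|\mathfrak m)/n)$ (equal to $0$ if $\mathrm{Ent}=+\infty$). $\mathcal P_{bs}^*$: probability measures with bounded support in $\mathrm{supp}\,\mathfrak m$ and finite entropy. The condition: for every $\bar x\in\mathrm{supp}\,\mathfrak m$ and $\mu_1\in\mathcal P_{bs}^*$ with $\bar x\notin\mathrm{supp}\,\mu_1$ there is a $W_2$-geodesic $(\mu_t)_{t\in[0,1]}$ from $\delta_{\bar x}$ to $\mu_1$ with $\mathrm U_n(\mu_t|\mathfrak m)\ge\exp\big(\frac1n\int\log\beta_t(\mathsf G(\bar x,x))\,\mu_1(dx)\big)\mathrm U_n(\mu_1|\mathfrak m)$ for all $t\in(0,1)$, for some (equivalently every) $n\ge1$. *)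

(* Defs.v *)
From HB Require Import structures.
From mathcomp Require Import all_boot all_order all_algebra.
From mathcomp Require Import all_classical all_reals all_analysis.
From mathcomp Require Import measurable_realfun ess_sup_inf.

Set Implicit Arguments.
Unset Strict Implicit.
Unset Printing Implicit Defensive.

Import Order.TTheory GRing.Theory Num.Theory.
Import numFieldNormedType.Exports.

Local Open Scope classical_set_scope.
Local Open Scope ring_scope.

(** Complete separable metric spaces with their Borel sigma-algebra. Like every
    measurable type of the library they are inhabited. *)
HB.mixin Record isPolishBorel (R : realType) (d : measure_display) X
    & Metric R X & Measurable d X := {
  measurable_borel : (@measurable d X) = <<s @open X >> ;
  separable_space : exists2 D : set X, countable D & dense D
}.

#[short(type="polishMetricType")]
HB.structure Definition PolishMetric (R : realType) (d : measure_display) :=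
  { X of Metric R X & Complete X & Measurable d X & isPolishBorel R d X }.

Section metric_measure.
Context {R : realType} {d : measure_display} {X : polishMetricType R d}.
Implicit Types (A S : set X) (x y : X) (m : {measure set X -> \bar R}).

Definition metric_bounded A := exists x (r : R), A `<=` ball x r.

Definition finite_on_bounded m :=
  forall A, measurable A -> metric_bounded A -> (m A < +oo)%E.

Definition msupport (m : set X -> \bar R) : set X :=
  [set x | forall U, open_nbhs x U -> (0 < m U)%E].

(** Measurability is with respect to the Borel sets of the product topology. *)
Definition gauge (G : X * X -> \bar R) :=
  (forall p, (0 <= G p)%E) /\
  forall B : set (\bar R), measurable B ->
    <<s @open (X * X)%type >> (G @^-1` B).

(** [f \_ A] extends [f] by 0 outside [A]; as [G] takes values in [0, +oo], this
    is the essential supremum in [0, +oo], equal to 0 over an [m]-null set. *)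
Definition gdiam m (G : X * X -> \bar R) S : \bar R :=
  ereal_sup [set ess_sup m ((fun y => G (x, y)) \_ (S `\ x)) | x in S].

Definition gbounded m (G : X * X -> \bar R) S :=
  S !=set0 /\ (gdiam m G S < +oo)%E.

End metric_measure.

Section distortion.
Context {R : realType}.
Implicit Types (s : R -> R) (N t : R).

Definition distortion_profile s N :=
  [/\ 1 <= N, {within `[0, +oo[, continuous s} &
      exists2 c : R, 0 < c &
        (s : R -> R^o) =
          (fun th => c * th `^ N) +o_ (0^'+) (fun th => th `^ N : R^o)].

Definition first_zero s : \bar R :=
  ereal_inf [set th%:E | th in [set th : R | 0 < th /\ s th = 0]].

Definition left_of (D : \bar R) : set_system R :=
  if D is a%:E then a^'- else +oo.

Definition distortion s N t (th : \bar R) : \bar R :=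
  if th == 0%E then (t `^ N)%:E
  else if (th < first_zero s)%E then (s (t * fine th) / s (fine th))%:E
  else limf_einf (fun ph : R => (s (t * ph) / s ph)%:E) (left_of (first_zero s)).

End distortion.

Section wasserstein.
Context {R : realType} {d : measure_display} {X : polishMetricType R d}.
Implicit Types (mu nu : probability X R) (m : {measure set X -> \bar R}).
Local Open Scope ereal_scope.

Definition finite_second_moment mu :=
  exists x0 : X, \int[mu]_x ((mdist x0 x ^+ 2)%R)%:E < +oo.

Definition coupling mu nu (pi : probability (X * X)%type R) :=
  forall A : set X, measurable A ->
    pi (A `*` setT) = mu A /\ pi (setT `*` A) = nu A.

Definition W2 mu nu : \bar R :=
  (ereal_inf [set \int[pi]_p ((mdist p.1 p.2 ^+ 2)%R)%:E |
              pi in [set pi | coupling mu nu pi]]) `^ (2^-1).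

(** Only the restriction of [mu_] to [0, 1] matters. *)
Definition W2_geodesic (mu_ : R -> probability X R) :=
  (forall t, (0 <= t <= 1)%R -> finite_second_moment (mu_ t)) /\
  forall t u, (0 <= t <= 1)%R -> (0 <= u <= 1)%R ->
    W2 (mu_ t) (mu_ u) = `|t - u|%R%:E * W2 (mu_ 0%R) (mu_ 1%R).

Definition density m mu (rho : X -> R) :=
  [/\ measurable_fun setT rho, (forall x, (0 <= rho x)%R) &
      forall A, measurable A -> mu A = \int[m]_(x in A) (rho x)%:E].

(** Densities of [mu] agree [m]-almost everywhere, so the set below has at most
    one element; when it is empty, the infimum is [+oo]. *)
Definition entropy m mu : \bar R :=
  ereal_inf [set \int[m]_x (rho x * ln (rho x))%:E |
    rho in [set rho | [/\ density m mu rho, finite_second_moment mu &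
      m.-integrable setT (fun x => (rho x * ln (rho x))%:E)]]].

Definition entropy_power m (n : R) mu : \bar R :=
  expeR (- ((n^-1)%:E * entropy m mu)).

Definition Pbs_star m mu :=
  [/\ metric_bounded (msupport mu), msupport mu `<=` msupport m &
      entropy m mu \is a fin_num].

(** An integral whose positive and negative parts are both infinite evaluates to
    [-oo]; the corresponding inequality below is then void. *)
Definition MCP m (G : X * X -> \bar R) (beta : R -> \bar R -> \bar R) :=
  exists2 n : R, (1 <= n)%R &
  forall (xb : X) (mu1 : probability X R),
    msupport m xb -> Pbs_star m mu1 -> ~ msupport mu1 xb ->
    exists mu_ : R -> probability X R,
      [/\ W2_geodesic mu_,
          (forall A, measurable A -> mu_ 0%R A = \d_xb A),
          (forall A, measurable A -> mu_ 1%R A = mu1 A) &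
          forall t, (0 < t < 1)%R ->
            expeR ((n^-1)%:E * \int[mu1]_x lne (beta t (G (xb, x))))
              * entropy_power m n mu1
            <= entropy_power m n (mu_ t)].

End wasserstein.

(* Main.v *)
(* The measure of A in B_r(x0) is contracted towards x0. Apply MCP to the
   normalised restriction of m to A, where A lies in an annulus around x0 and,
   up to a null set, beta_t(G(x0, .)) is at least kappa on A. This restriction
   has entropy power m(A)^(1/n). A point of a W_2-geodesic starting at a Dirac
   mass is the dilation of the endpoint as far as the distance to x0 is
   concerned, so mu_t is concentrated on the annulus with radii multiplied by t,
   and by Jensen its entropy power is at most the measure of that annulus to the
   power 1/n. Hence kappa m(A) <= m(B_tr(x0) minus x0). Exhausting B_r(x0) minus
   x0 by annuli leaves only the point x0, which may be an atom of m; it is added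
   back to both sides since kappa <= t^N <= 1.

   Optimal couplings and geodesics in X are not needed: the statement on
   distances follows from almost optimal couplings and the convexity identity
   in [mdist_parallelogram] together with Chebyshev's inequality. *)

Require Import Defs.
From HB Require Import structures.
From mathcomp Require Import all_boot all_order all_algebra.
From mathcomp Require Import all_classical all_reals all_analysis.
From mathcomp Require Import measurable_realfun ess_sup_inf.
From mathcomp Require Import ring lra.

Set Implicit Arguments.
Unset Strict Implicit.
Unset Printing Implicit Defensive.

Import Order.TTheory GRing.Theory Num.Theory.
Import numFieldNormedType.Exports.

Local Open Scope classical_set_scope.
Local Open Scope ring_scope.
Local Open Scope ereal_scope.

(** * Positive lower bounds for distortion coefficients *)

Section distortion_bounds.
Context {R : realType}.
Implicit Types (s : R -> R) (N t : R).
Local Open Scope ring_scope.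

(** The tolerance [c / 2] in the little-o gives the factors 1/2 and 3/2, the latter rounded up to
    2. *)
Lemma distortion_profile_near0 s N : distortion_profile s N ->
  exists c h : R, [/\ 0 < c, 0 < h & forall x, 0 < x < h ->
    c * x `^ N / 2 <= s x <= c * x `^ N * 2].
Proof.
move=> [N1 _ [c c0 /eqaddoP /(_ (c / 2))]].
rewrite divr_gt0// => /(_ isT) [h /= h0 sh].
exists c, h; split=> // x /andP[x0 xh].
have := sh x; rewrite /= sub0r normrN gtr0_norm// => /(_ xh x0).
rewrite !fctE (ger0_norm (powR_ge0 _ _)) ler_norml.
have : 0 <= c * x `^ N by rewrite mulr_ge0 ?powR_ge0// ltW.
rewrite (_ : c / 2 * _ = c * x `^ N / 2); last by ring.
move: (c * x `^ N) (s x) => a b a0.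
lra.
Qed.

(** Since [s] is positive close to 0, a nonpositive value at [x] would produce, by the intermediate
    value theorem, a zero in [[h / 2, x]], hence below [first_zero s]. *)
Lemma distortion_profile_gt0 s N x : distortion_profile s N ->
  0 < x -> (x%:E < first_zero s)%E -> 0 < s x.
Proof.
move=> sp x0 xD.
have [c [h [c0 h0 sh]]] := distortion_profile_near0 sp.
have s0 y : 0 < y < h -> 0 < s y.
  move=> yh; have /andP[+ _] := sh _ yh; apply: lt_le_trans.
  by case/andP: yh => y0 _; rewrite divr_gt0// mulr_gt0// powR_gt0.
have [xh|hx] := ltP x h; first by rewrite s0// x0.
rewrite ltNge; apply/negP => sx.
have h2h : 0 < h / 2 < h by lra.
have [|||y] := @IVT R s (h / 2) x 0.
- lra.
- case: sp => _ sc _; apply: continuous_subspaceW sc => y /=.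
  by rewrite !in_itv/= andbT => /andP[+ _]; apply: le_trans; lra.
- by rewrite ge_min le_max sx orbT (ltW (s0 _ h2h)).
rewrite in_itv/= => /andP[hy yx] sy.
suff : (first_zero s <= x%:E)%E by rewrite leNgt xD.
apply: ge_ereal_inf; exists y%:E; last by rewrite lee_fin.
by exists y => //=; split=> //; lra.
Qed.

(** Near 0 both terms are comparable to powers. On [[h, M]] the numerator is at least the minimum of
    [s] on [[t h, t M]], which is positive, and the denominator is bounded by compactness. The
    condition bears on [t * M], so that [M] may be the first zero itself. *)
Lemma distortion_profile_ratio_lb s N t M : distortion_profile s N ->
  0 < t < 1 -> ((t * M)%:E < first_zero s)%E ->
  exists2 k, 0 < k & forall x, 0 < x -> x <= M -> (x%:E < first_zero s)%E ->
    k <= s (t * x) / s x.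
Proof.
move=> sp /andP[t0 t1] tMD.
have [c [h [c0 h0 sh]]] := distortion_profile_near0 sp.
(* The quotient of the bounds [c (t x)^N / 2] and [2 c x^N] is [t^N / 4]. *)
have near0 x : 0 < x < h -> t `^ N / 4 <= s (t * x) / s x.
  move=> xh; have /andP[sx1 sx2] := sh _ xh; case/andP: xh => x0 xh.
  have /sh/andP[+ _] : 0 < t * x < h.
    by rewrite mulr_gt0//= (lt_trans _ xh)// gtr_pMl.
  have cx0 : 0 < c * x `^ N by rewrite mulr_gt0 ?powR_gt0.
  rewrite ler_pdivlMr; last lra.
  rewrite powRM ?(ltW t0) ?(ltW x0)// => stx; apply: le_trans stx.
  have := @powR_ge0 _ t N.
  by move=> tN; nra.
have tN0 : 0 < t `^ N / 4 by rewrite divr_gt0// powR_gt0.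
have [Mh|hM] := ltP M h.
  exists (t `^ N / 4) => // x x0 xM _; apply: near0.
  by rewrite x0 (le_lt_trans xM).
have [_ sc _] := sp.
have thM : t * h <= t * M by rewrite ler_pM2l.
have [||u uin umin] := @EVT_min R s (t * h) (t * M) => //.
  apply: continuous_subspaceW sc => y /=.
  rewrite !in_itv/= andbT => /andP[+ _]; apply: le_trans.
  by rewrite mulr_ge0 ?ltW.
have su0 : 0 < s u.
  move: uin; rewrite in_itv/= => /andP[uh uM].
  apply: (distortion_profile_gt0 sp).
    by rewrite (lt_le_trans _ uh)// mulr_gt0.
  by rewrite (le_lt_trans _ tMD)// lee_fin.
have [||v _ vmax] := @EVT_max R s h M => //.
  apply: continuous_subspaceW sc => y /=.
  by rewrite !in_itv/= andbT => /andP[+ _]; apply: le_trans; rewrite ltW.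
(* Adding 1 keeps the denominator positive, the absolute value being only known to be
   nonnegative. *)
exists (Num.min (t `^ N / 4) (s u / (`|s v| + 1))).
  by rewrite lt_min tN0 divr_gt0// ltr_wpDl.
move=> x x0 xM xD; rewrite ge_min.
have [xh|hx] := ltP x h; first by rewrite near0// x0.
have sx0 := distortion_profile_gt0 sp x0 xD.
apply/orP; right; apply: ler_pM.
- exact: ltW.
- by rewrite invr_ge0 addr_ge0.
- by apply: umin; rewrite in_itv/= !ler_pM2l// hx xM.
- rewrite lef_pV2 ?posrE ?ltr_wpDl// (le_trans (vmax x _))//.
    by rewrite in_itv/= hx.
  by rewrite (le_trans (ler_norm _))// lerDl.
Qed.

Lemma first_zero_gt0 s N : distortion_profile s N -> (0 < first_zero s)%E.
Proof.
move=> sp; have [c [h [c0 h0 sh]]] := distortion_profile_near0 sp.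
apply: (@lt_le_trans _ _ h%:E); first by rewrite lte_fin.
apply: le_ereal_inf_tmp => _ [x /= [x0 sx0] <-]; rewrite lee_fin leNgt.
apply/negP => xh; have := sh x; rewrite x0 xh sx0 => /(_ isT)/andP[+ _].
by rewrite leNgt divr_gt0// mulr_gt0// powR_gt0.
Qed.

(** This is what makes the infimum of [beta_t] in the theorem positive. *)
Lemma distortion_lb s N t (M : R) : distortion_profile s N -> 0 < t < 1 ->
  exists2 k : R, 0 < k & forall th : \bar R, (0 <= th)%E -> (th <= M%:E)%E ->
    (k%:E <= distortion s N t th)%E.
Proof.
move=> sp /[dup] t01 /andP[t0 t1].
have D0 := first_zero_gt0 sp.
(* [M'] is [M] if [M] lies below the first zero, and the first zero otherwise; in both cases
   [t * M'] lies strictly below the first zero. *)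
have [M' [tM'D MM' DM']] : exists M' : R, [/\ ((t * M')%:E < first_zero s)%E,
    (M%:E < first_zero s)%E -> M <= M' &
    ~~ (M%:E < first_zero s)%E -> first_zero s = M'%:E].
  have [MD|] := boolP (M%:E < first_zero s)%E.
    exists M; split=> //; have [M0|M0] := leP 0 M.
      by rewrite (le_lt_trans _ MD)// lee_fin ler_piMl// ltW.
    by rewrite (lt_trans _ D0)// lte_fin pmulr_rlt0.
  rewrite -leNgt; case: (first_zero s) D0 => // D; rewrite lte_fin => D0 _.
  by exists D; split=> //; rewrite lte_fin gtr_pMl.
have [k k0 kle] := distortion_profile_ratio_lb sp t01 tM'D.
exists (Num.min k (t `^ N)); first by rewrite lt_min k0 powR_gt0.
move=> th th0 thM; rewrite /distortion; case: eqVneq => [_|thn0].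
  by rewrite lee_fin ge_min lexx orbT.
have {th0 thn0} th0 : (0 < th)%E by rewrite lt_neqAle eq_sym thn0.
case: th th0 thM => // th; rewrite lte_fin lee_fin => th0 thM.
case: ifPn => [thD|thD].
  rewrite /= lee_fin ge_min kle//.
  have [/MM'|MD] := boolP (M%:E < first_zero s)%E; first exact: le_trans.
  by rewrite -lee_fin -DM'// ltW.
have MD : ~~ (M%:E < first_zero s)%E.
  by apply: contra thD; apply: le_lt_trans; rewrite lee_fin.
(* From the first zero on, the coefficient is a lower limit, which is at least the infimum of the
   quotient over the left neighbourhood []0, M'[], where [k] is a lower bound. *)
rewrite limf_einfE DM'//=; apply: le_ereal_sup_tmp.
have M'0 : 0 < M' by rewrite -lte_fin -DM'.
exists (ereal_inf [set (s (t * ph) / s ph)%:E | ph in `]0, M'[ ]).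
  exists [set` `]0, M'[] => //=.
  near=> x; rewrite /= in_itv/=; apply/andP; split; near: x.
    exact: nbhs_left_gt.
  exact: nbhs_left_lt.
apply: le_ereal_inf_tmp => _ [x /= + <-]; rewrite in_itv/= => /andP[x0 xM'].
by rewrite lee_fin ge_min (kle _ x0 (ltW xM'))// (DM' MD) lte_fin.
Unshelve. all: by end_near.
Qed.

End distortion_bounds.

(** * Measurability of the distance *)

Section metric_measurability.
Context {R : realType} {d : measure_display} {X : polishMetricType R d}.
Local Open Scope ring_scope.

Lemma open_measurable_polish (U : set X) : open U -> measurable U.
Proof.
by move=> oU; rewrite (@measurable_borel R d X); exact: sub_sigma_algebra.
Qed.

Lemma open_mdist_lt (x : X) (r : R) : open [set y | mdist x y < r].
Proof.
rewrite openE => y /= yr.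
rewrite /interior -metricType_numDomainType.filter_from_mdist_nbhs /=.
exists (r - mdist x y); first by rewrite /= subr_gt0.
by move=> z /= zy; have := metric_triangle x y z; lra.
Qed.

Lemma open_mdist_gt (x : X) (r : R) : open [set y | r < mdist x y].
Proof.
rewrite openE => y /= yr.
rewrite /interior -metricType_numDomainType.filter_from_mdist_nbhs /=.
exists (mdist x y - r); first by rewrite /= subr_gt0.
move=> z /= zy; have := metric_triangle x z y; rewrite (metric_sym z y).
by move: zy; lra.
Qed.

Lemma measurable_point (x : X) : measurable [set x].
Proof.
rewrite -[X in measurable X]setCK (_ : [set~ x] = [set y | 0 < mdist x y]).
  exact/measurableC/open_measurable_polish/open_mdist_gt.
by apply/seteqP; split=> y /=; rewrite mdist_gt0 eq_sym => /eqP.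
Qed.

Lemma measurable_mdist (x : X) : measurable_fun setT (mdist x).
Proof.
apply: (measurability _ (RGenInftyO.measurableE R)) => _ /= -[_ [r ->] <-].
rewrite setTI; apply: open_measurable_polish.
rewrite (_ : _ @^-1` _ = [set y | mdist x y < r]); first exact: open_mdist_lt.
by apply/seteqP; split => y /=; rewrite in_itv.
Qed.

(** For the product sigma-algebra, openness in [X * X] does not settle this directly. By density of
    [D], [mdist x y < r] holds iff [mdist z x + mdist z y < r] for some [z] in [D]: a countable
    union of product-measurable sets. *)
Lemma measurable_mdist2 :
  measurable_fun setT (fun p : X * X => mdist p.1 p.2).
Proof.
have [D Dcount Ddense] := @separable_space R d X.
apply: (measurability _ (RGenInftyO.measurableE R)) => _ /= -[_ [r ->] <-].
rewrite setTI (_ : _ @^-1` _ =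
    \bigcup_(z in D) [set p | mdist z p.1 + mdist z p.2 < r]); last first.
  apply/seteqP; split => -[x y] /=; rewrite in_itv/=.
    move=> xyr; have e0 : 0 < (r - mdist x y) / 2 by lra.
    have [||z [/= zx Dz]] := Ddense [set z | mdist x z < (r - mdist x y) / 2].
    - by exists x; rewrite /= mdistxx.
    - exact: open_mdist_lt.
    exists z => //=; have := metric_triangle z x y; rewrite (metric_sym z x).
    by move: zx; lra.
  move=> [z Dz /= zr]; have := metric_triangle x z y; rewrite (metric_sym x z).
  lra.
have /pcard_surjP[f f_surj] := Dcount.
rewrite (_ : \bigcup_(z in D) _ =
    \bigcup_(n in f @^-1` D) [set p | mdist (f n) p.1 + mdist (f n) p.2 < r]).
  apply: bigcup_measurable => n _.
  have mf : measurable_fun setT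
      (fun p : X * X => mdist (f n) p.1 + mdist (f n) p.2).
    by apply: measurable_funD; apply: measurableT_comp (measurable_mdist _) _.
  have := mf measurableT _ (measurable_itv `]-oo, r[).
  by rewrite setTI.
apply/seteqP; split=> p [z Dz pz]; last by exists (f z).
have [n _ fnz] := f_surj _ Dz.
by exists n => /=; rewrite fnz.
Qed.

End metric_measurability.

(** * Wasserstein geodesics issuing from a Dirac mass *)

Section geodesics_from_a_dirac_mass.
Context {R : realType} {d : measure_display} {X : polishMetricType R d}.
Implicit Types mu nu : probability X R.

Lemma integral_fst_coupling mu nu pi (h : X -> \bar R) : coupling mu nu pi ->
  measurable_fun setT h -> (forall x, 0 <= h x) ->
  \int[pi]_p h p.1 = \int[mu]_x h x.
Proof.
move=> cpl mh h0.
rewrite -[LHS](@ge0_integral_pushforward _ _ _ _ _ _ measurable_fst pi setT h)//.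
apply: eq_measure_integral => A mA _.
have [+ _] := cpl A mA; apply: etrans; congr (pi _).
by apply/seteqP; split=> -[x y] //= [].
Qed.

Lemma integral_snd_coupling mu nu pi (h : X -> \bar R) : coupling mu nu pi ->
  measurable_fun setT h -> (forall x, 0 <= h x) ->
  \int[pi]_p h p.2 = \int[nu]_x h x.
Proof.
move=> cpl mh h0.
rewrite -[LHS](@ge0_integral_pushforward _ _ _ _ _ _ measurable_snd pi setT h)//.
apply: eq_measure_integral => A mA _.
have [_] := cpl A mA; apply: etrans; congr (pi _).
by apply/seteqP; split=> -[x y] //= [].
Qed.

Lemma measurable_sqr_mdist (x : X) :
  measurable_fun setT (fun y => (mdist x y ^+ 2)%:E).
Proof.
apply/measurable_EFinP; apply: measurable_funX; exact: measurable_mdist.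
Qed.

Lemma measurable_sqr_mdist2 :
  measurable_fun setT (fun p : X * X => (mdist p.1 p.2 ^+ 2)%:E).
Proof.
apply/measurable_EFinP; apply: measurable_funX; exact: measurable_mdist2.
Qed.

(** Every coupling of a Dirac mass with [nu] is concentrated on pairs [(x0, y)], so its cost depends
    on [nu] alone. *)
Lemma W2_dirac_l mu nu (x0 : X) : (forall A, measurable A -> mu A = \d_x0 A) ->
  W2 mu nu = (\int[nu]_x (mdist x0 x ^+ 2)%:E) `^ 2^-1.
Proof.
move=> muE; rewrite /W2; congr (_ `^ _).
have sqr0 (x : X) : 0 <= (mdist x0 x ^+ 2)%:E by rewrite lee_fin sqr_ge0.
have mx0 : measurable [set~ x0] by exact/measurableC/measurable_point.
have costE pi : coupling mu nu pi ->
    \int[pi]_p (mdist p.1 p.2 ^+ 2)%:E = \int[nu]_x (mdist x0 x ^+ 2)%:E.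
  move=> cpl; rewrite -(integral_snd_coupling cpl (measurable_sqr_mdist x0) sqr0).
  apply: ge0_ae_eq_integral => //.
  - exact: measurable_sqr_mdist2.
  - by apply: measurableT_comp (measurable_sqr_mdist x0) _.
  - by move=> p _; rewrite lee_fin sqr_ge0.
  exists ([set~ x0] `*` setT); split; first exact: measurableX.
    have [piN _] := cpl _ mx0.
    by rewrite muE// diracE memNset//= in piN => /(_ erefl).
  move=> -[x y] /= /not_implyP[_ xy]; split=> // xx0; apply: xy.
  by rewrite xx0.
have mpair : measurable_fun setT (fun y : X => (x0, y)).
  exact: measurable_fun_pair.
(* A coupling has to exist, as the infimum of the empty set is [+oo]; the image of [nu] under
   [y |-> (x0, y)] is one. *)
pose f : {mfun X >-> (X * X)%type} := HB.pack (fun y : X => (x0, y))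
  (isMeasurableFun.Build _ _ _ _ _ mpair).
have cplf : coupling mu nu (distribution nu f).
  move=> A mA; rewrite /distribution /pushforward; split.
    rewrite muE// diracE; case: (asboolP (A x0)) => x0A.
      rewrite mem_set//= -[RHS](probability_setT nu); congr (nu _).
      by apply/seteqP; split.
    rewrite memNset//= -[RHS](measure0 nu); congr (nu _).
    by apply/seteqP; split => // y [].
  by congr (nu _); apply/seteqP; split => y // [].
rewrite (_ : [set _ | _ in _] = [set \int[nu]_x (mdist x0 x ^+ 2)%:E]).
  by rewrite ereal_inf1.
apply/seteqP; split => [_ [pi /= cpl <-]|_ ->]; first exact: costE.
by exists (distribution nu f) => //; exact: costE.
Qed.

Lemma poweR_half_eq (x : \bar R) (c : R) : (0 <= c)%R -> 0 <= x ->
  x `^ 2^-1 = c%:E -> x = (c ^+ 2)%:E.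
Proof.
case: x => [x| |] c0 //=; last by rewrite invr_eq0 pnatr_eq0.
rewrite lee_fin => x0 [/esym ->].
by rewrite powR12_sqrt// sqr_sqrtr.
Qed.

(* [(1 - t) a^2 + t (c - a)^2 = t (1 - t) c^2 + (a - t c)^2], with [a] and [c]
   the distances from [x0] to [x] and [y] *)
Lemma mdist_parallelogram (x0 x y : X) (t : R) : (0 < t)%R ->
  (t * (1 - t) * mdist x0 y ^+ 2 + (mdist x0 x - t * mdist x0 y) ^+ 2
    <= (1 - t) * mdist x0 x ^+ 2 + t * mdist x y ^+ 2)%R.
Proof.
move=> t0.
have := metric_triangle x0 x y; have := metric_triangle x0 y x.
rewrite (metric_sym y x); have := mdist_ge0 x y.
move: (mdist x0 x) (mdist x0 y) (mdist x y) => a c l l0 h1 h2.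
have H : ((c - a) ^+ 2 <= l ^+ 2)%R by nra.
rewrite -subr_ge0.
rewrite (_ : _ - _ = t * (l ^+ 2 - (c - a) ^+ 2))%R; last by ring.
by rewrite mulr_ge0 ?subr_ge0// ltW.
Qed.

Lemma measurable_sqr_deviation (x0 : X) (t : R) : measurable_fun setT
  (fun p : X * X => ((mdist x0 p.1 - t * mdist x0 p.2) ^+ 2)%:E).
Proof.
apply/measurable_EFinP; apply: measurable_funX; apply: measurable_funB.
  by apply: measurableT_comp (measurable_mdist x0) _.
apply: measurable_funM => //.
by apply: measurableT_comp (measurable_mdist x0) _.
Qed.

(** This is [mdist_parallelogram] integrated against [pi], with the marginals evaluated. *)
Lemma coupling_deviation mu nu pi (x0 : X) (t : R) : (0 < t < 1)%R ->
  coupling mu nu pi ->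
  (t * (1 - t))%:E * \int[nu]_y (mdist x0 y ^+ 2)%:E
    + \int[pi]_p ((mdist x0 p.1 - t * mdist x0 p.2) ^+ 2)%:E
  <= (1 - t)%:E * \int[mu]_x (mdist x0 x ^+ 2)%:E
    + t%:E * \int[pi]_p (mdist p.1 p.2 ^+ 2)%:E.
Proof.
move=> /andP[t0 t1] cpl.
have sqr0 (r : R) : 0 <= (r ^+ 2)%:E by rewrite lee_fin sqr_ge0.
have m1 : measurable_fun setT (fun p : X * X => (mdist x0 p.1 ^+ 2)%:E).
  by apply: measurableT_comp (measurable_sqr_mdist x0) _.
have m2 : measurable_fun setT (fun p : X * X => (mdist x0 p.2 ^+ 2)%:E).
  by apply: measurableT_comp (measurable_sqr_mdist x0) _.
have md := measurable_sqr_deviation x0 t.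
have tt0 : (0 <= t * (1 - t))%R by rewrite mulr_ge0 ?subr_ge0 ?ltW.
have tt1 : (0 <= 1 - t)%R by rewrite subr_ge0 ltW.
rewrite -(integral_fst_coupling cpl (measurable_sqr_mdist x0) (fun=> sqr0 _)).
rewrite -(integral_snd_coupling cpl (measurable_sqr_mdist x0) (fun=> sqr0 _)).
have t0' : (0 <= t)%R by exact: ltW.
have md2 := measurable_sqr_mdist2.
rewrite -!ge0_integralZl_EFin//.
rewrite -!ge0_integralD//.
- apply: ge0_le_integral => //.
  + by move=> p _; rewrite adde_ge0// mule_ge0.
  + by apply: emeasurable_funD => //; apply: measurable_funeM.
  + apply: emeasurable_funD; exact: measurable_funeM.
  + by move=> [x y] _ /=; rewrite -!EFinM -!EFinD lee_fin mdist_parallelogram.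
- by move=> p _; rewrite mule_ge0.
- exact: measurable_funeM.
- by move=> p _; rewrite mule_ge0.
- exact: measurable_funeM.
- by move=> p _; rewrite mule_ge0.
- exact: measurable_funeM.
Qed.

Lemma measurable_annulus (x0 : X) (a b : R) :
  measurable [set x | (a <= mdist x0 x <= b)%R].
Proof.
have := measurable_mdist x0 measurableT (measurable_itv `[a, b]).
rewrite setTI; congr (measurable _).
Qed.

Lemma integral_sqr_mdist_lty nu (x0 : X) (A : set X) (b : R) :
  measurable A -> nu A = 1 -> (forall x, A x -> (mdist x0 x <= b)%R) ->
  \int[nu]_x (mdist x0 x ^+ 2)%:E < +oo.
Proof.
move=> mA nuA Ab.
have nuNA : nu (~` A) = 0 by rewrite probability_setC// nuA subee.
have mf := measurable_sqr_mdist x0.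
rewrite (ge0_negligible_integral (measurableC mA) measurableT mf _ nuNA).
  rewrite setTD setCK.
  apply: (@le_lt_trans _ _ (\int[nu]_(x in A) (b ^+ 2)%:E)).
    apply: ge0_le_integral => //.
    - by move=> x _; rewrite lee_fin sqr_ge0.
    - exact: measurable_funTS.
    - move=> x /Ab xb; rewrite lee_fin.
      by rewrite lerXn2r ?nnegrE ?mdist_ge0// (le_trans _ xb)// mdist_ge0.
  by rewrite integral_cst//= nuA mule1 ltry.
by move=> x _; rewrite lee_fin sqr_ge0.
Qed.

(** With [I] the second moment of [mu_ 1] about [x0], that of [mu_ t] is [t^2 I], and the squared
    distance from [mu_ t] to [mu_ 1] is [(1 - t)^2 I]. For an optimal cost these values leave no
    room for the deviation in [coupling_deviation], so under nearly optimal couplings [mdist x0 x]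
    is close to [t * mdist x0 y]. The slack [e] is the threshold in Chebyshev's inequality. *)
Lemma W2_geodesic_dirac_annulus (mu_ : R -> probability X R) (x0 : X)
    (a b t e : R) :
  W2_geodesic mu_ -> (forall A, measurable A -> mu_ 0%R A = \d_x0 A) ->
  mu_ 1%R [set x | (a <= mdist x0 x <= b)%R] = 1 ->
  (0 < t < 1)%R -> (0 < e)%R ->
  mu_ t [set x | (t * a - e <= mdist x0 x <= t * b + e)%R] = 1.
Proof.
move=> [_ geo] mu0E mu1A /[dup] t01 /andP[t0 t1] e0.
set A := [set x | _] in mu1A; set B := [set x | _].
have mA : measurable A by exact: measurable_annulus.
have mB : measurable B by exact: measurable_annulus.
have sqr0 (r : R) : 0 <= (r ^+ 2)%:E by rewrite lee_fin sqr_ge0.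
have mu1NA : mu_ 1%R (~` A) = 0 by rewrite probability_setC// mu1A subee.
have I1fin : \int[mu_ 1%R]_x (mdist x0 x ^+ 2)%:E < +oo.
  apply: (integral_sqr_mdist_lty mA mu1A (b := b)) => x /= /andP[_ xb].
  exact: xb.
have I1ge0 nu : 0 <= \int[nu]_x (mdist x0 x ^+ 2)%:E by apply: integral_ge0.
case I1E : (\int[mu_ 1%R]_x (mdist x0 x ^+ 2)%:E)
  I1fin (I1ge0 (mu_ 1%R)) => [i1| |] //.
rewrite lee_fin => _ i10.
have W01 : W2 (mu_ 0%R) (mu_ 1%R) = (Num.sqrt i1)%:E.
  by rewrite (W2_dirac_l _ mu0E) I1E poweR_EFin powR12_sqrt.
have ItE : \int[mu_ t]_x (mdist x0 x ^+ 2)%:E = (t ^+ 2 * i1)%:E.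
  have : W2 (mu_ 0%R) (mu_ t) = (t * Num.sqrt i1)%:E.
    rewrite geo ?lexx ?ler01 ?ltW// W01 sub0r normrN gtr0_norm//.
  rewrite (W2_dirac_l _ mu0E) => /poweR_half_eq ->//.
    by rewrite exprMn sqr_sqrtr.
  by rewrite mulr_ge0 ?sqrtr_ge0 ?ltW.
have W1t : W2 (mu_ t) (mu_ 1%R) = ((1 - t) * Num.sqrt i1)%:E.
  by rewrite geo ?lexx ?ler01 ?ltW// W01 distrC gtr0_norm ?subr_gt0.
set K := [set \int[pi]_p ((mdist p.1 p.2 ^+ 2)%R)%:E |
              pi in [set pi | coupling (mu_ t) (mu_ 1%R) pi]].
have KE : ereal_inf K = ((1 - t) ^+ 2 * i1)%:E.
  have := poweR_half_eq _ _ W1t; rewrite exprMn sqr_sqrtr//; apply.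
    by rewrite mulr_ge0 ?sqrtr_ge0// subr_ge0 ltW.
  by apply: le_ereal_inf_tmp => _ [pi _ <-]; apply: integral_ge0.
suff : mu_ t (~` B) = 0.
  move=> mutB; rewrite -[B]setCK probability_setC; last exact: measurableC.
  by rewrite mutB sube0.
apply/eqP; rewrite eq_le measure_ge0 andbT; apply/lee_addgt0Pr => eta eta0.
rewrite add0e.
have Kfin : ereal_inf K \is a fin_num by rewrite KE.
(* In the tolerance, [t] cancels the factor of the cost in [coupling_deviation] and [e ^+ 2] the
   Chebyshev factor, so that [eta] remains. *)
have [|_ [pi cpl <-]] := @lb_ereal_inf_adherent _ K (eta * e ^+ 2 / t) _ Kfin.
  by rewrite divr_gt0// mulr_gt0// exprn_gt0.
rewrite KE -EFinD => cost.
have := coupling_deviation x0 t01 cpl; rewrite ItE I1E.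
set dev := \int[pi]_p _ => devle.
have devle2 : dev <= (eta * e ^+ 2)%:E.
  have : (t * (1 - t))%:E * i1%:E + dev <=
      (1 - t)%:E * (t ^+ 2 * i1)%:E
        + t%:E * ((1 - t) ^+ 2 * i1 + eta * e ^+ 2 / t)%:E.
    apply: (le_trans devle); rewrite leeD2l//.
    by apply: lee_wpmul2l; [rewrite lee_fin ltW|exact: ltW].
  (* The moments cancel because [(1 - t) t^2 + t (1 - t)^2 = t (1 - t)]. *)
  rewrite -!EFinM -!EFinD addeC -leeBrDr// -EFinB => /le_trans; apply.
  rewrite lee_fin le_eqVlt; apply/orP; left; apply/eqP; field.
  by rewrite gt_eqF.
have mBA : measurable (~` B `*` A) by exact: measurableX (measurableC mB) mA.
(* The second marginal does not charge the complement of [A], so the second point may be taken in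
   [A]. *)
have piE : mu_ t (~` B) <= pi (~` B `*` A).
  have [<- _] := cpl _ (measurableC mB).
  have [_ piNA] := cpl _ (measurableC mA).
  rewrite mu1NA in piNA.
  rewrite -[leRHS]adde0 -piNA.
  have mNA : measurable (setT `*` ~` A : set (X * X)).
    exact: measurableX measurableT (measurableC mA).
  apply: le_trans (measureU2 _ _ _) => //.
  apply: le_measure; rewrite ?inE//.
  - exact: measurableX (measurableC mB) measurableT.
  - exact: measurableU.
  - move=> -[x y] /= [Bx _]; have [Ay|Ay] := pselect (A y); [left|right] => //.
(* Chebyshev: for [x] outside [B] and [y] in [A] the deviation exceeds [e] in absolute value. *)
have : (e ^+ 2)%:E * mu_ t (~` B) <= dev.
  apply: (@le_trans _ _ ((e ^+ 2)%:E * pi (~` B `*` A))).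
    by apply: lee_wpmul2l.
  have md := measurable_sqr_deviation x0 t.
  rewrite -integral_cst//; apply: (@le_trans _ _ (\int[pi]_(p in ~` B `*` A)
      ((mdist x0 p.1 - t * mdist x0 p.2) ^+ 2)%:E)); last first.
    exact: ge0_subset_integral.
  apply: ge0_le_integral => //.
  - by move=> p _; rewrite lee_fin sqr_ge0.
  - exact: measurable_funTS.
  - move=> -[x y] /= [/negP + /andP[ya yb]]; rewrite negb_and -!ltNge lee_fin.
    move: (mdist x0 x) (mdist x0 y) ya yb => u v av vb.
    have := ler_wpM2l (ltW t0) av; have := ler_wpM2l (ltW t0) vb => tvb tav.
    by case/orP => H; nra.
move=> /le_trans/(_ devle2); rewrite (EFinM eta) (muleC eta%:E).
by rewrite lee_pmul2l// lte_fin exprn_gt0.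
Qed.

End geodesics_from_a_dirac_mass.

(** * Lower bounds for integrals of arbitrary functions *)

Section integral_lower_bound.
Context {R : realType} {d : measure_display} {T : measurableType d}.
Implicit Types f g : T -> \bar R.

(* Both integrals are suprema over the simple functions below the integrand, so
   no measurability is needed. *)
Lemma le_integralT (mu : {measure set T -> \bar R}) f g :
  (forall x, f x <= g x) -> \int[mu]_x f x <= \int[mu]_x g x.
Proof.
have ge0 (h k : T -> \bar R) : (forall x, 0 <= h x) -> (forall x, h x <= k x) ->
    \int[mu]_x h x <= \int[mu]_x k x.
  move=> h0 hk; rewrite !ge0_integralTE//; last first.
    by move=> x; exact: le_trans (h0 x) (hk x).
  apply: ereal_sup_le => _ [u /= uh <-]; exists u => // x.
  exact: le_trans (uh x) (hk x).
move=> fg; have {}fg : {in setT, forall x, f x <= g x} by move=> x _.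
rewrite integralE [leRHS]integralE; apply: leeB; apply: ge0 => // x.
  exact: funepos_le fg _ (in_setT x).
exact: funeneg_le fg _ (in_setT x).
Qed.

(** The comparison function is measurable: it equals [c] on [A] and [-oo] on the null complement.
    The lemma serves for [lne (beta t (G (x0, x)))] with an arbitrary [beta]. *)
Lemma integral_ge_cst (mu : probability T R) (A : set T) f (c : R) :
  measurable A -> mu A = 1 -> (forall x, A x -> c%:E <= f x) ->
  c%:E <= \int[mu]_x f x.
Proof.
move=> mA muA cf.
have muNA : mu (~` A) = 0 by rewrite probability_setC// muA subee.
have mk : measurable_fun setT (fun x => if x \in A then c%:E else -oo).
  apply: measurable_fun_ifT => //; apply: (measurable_fun_bool true) => //.
  rewrite setTI (_ : _ @^-1` _ = A)//.
  by apply/seteqP; split => x /=; [move/set_mem|move/mem_set].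
apply: le_trans
  (le_integralT (f := fun x => if x \in A then c%:E else -oo) _ _).
  rewrite (@ae_eq_integral _ _ _ mu setT (cst c%:E))//.
    by rewrite integral_cst// [X in _ * X]probability_setT mule1.
  exists (~` A); split; first exact: measurableC.
    exact: muNA.
  by move=> x /=; apply: contra_not => Ax _; rewrite mem_set.
by move=> x; case: ifPn => [/set_mem/cf|_]//; rewrite leNye.
Qed.

End integral_lower_bound.

(** * Jensen's inequality for the entropy *)

Section entropy_estimates.
Context {R : realType} {d : measure_display} {X : polishMetricType R d}.
Implicit Types (m : {measure set X -> \bar R}) (mu : probability X R).

(* The tangent to [u ln u] at [u = 1 / v]; for [v = m B] it yields Jensen's
   inequality in [entropy_ge] *)
Lemma mul_ln_ge_tangent (u v : R) : (0 <= u)%R -> (0 < v)%R ->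
  ((1 - ln v) * u - v^-1 <= u * ln u)%R.
Proof.
move=> u0 v0; have [->|un0] := eqVneq u 0%R.
  by rewrite mulr0 mul0r sub0r oppr_le0 invr_ge0 ltW.
have {u0 un0} u0 : (0 < u)%R by rewrite lt_neqAle eq_sym un0.
have uv0 : (0 < (u * v)^-1)%R by rewrite invr_gt0 mulr_gt0.
have := @le_ln1Dx R ((u * v)^-1 - 1); rewrite ltrBDr addNr uv0 => /(_ isT).
rewrite addrC subrK lnV ?posrE ?mulr_gt0// lnM ?posrE//.
rewrite -(ler_pM2l u0) mulrBr mulr1 invfM mulrA divff ?gt_eqF// mul1r.
lra.
Qed.

(** As [rho] has integral 1 over [B], integrating the tangent inequality with [v = m B] over [B]
    gives [(1 - ln v) - 1 = - ln v]. *)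
Lemma entropy_ge m mu (B : set X) : measurable B -> mu B = 1 ->
  - lne (m B) <= entropy m mu.
Proof.
move=> mB muB; apply: le_ereal_inf_tmp => _ [rho [[mrho rho0 rhoE] _ Fint] <-].
have mrhoE : measurable_fun setT (EFin \o rho) by exact/measurable_EFinP.
(* For infinite [m B] the left-hand side is [-oo]. *)
have [->|mBfin] := eqVneq (m B) +oo; first by rewrite /= leNye.
have {mBfin} : m B \is a fin_num by rewrite ge0_fin_numE// ltey.
case mBE : (m B) => [b| |]// _.
have : 0 <= m B by exact: measure_ge0.
rewrite mBE lee_fin => b_ge0; have [b0|b0] := eqVneq b 0%R.
  have mB0 : m B = 0 by rewrite mBE b0.
  have := rhoE _ mB.
  rewrite muB (null_set_integral mB (measurable_funTS mrhoE) mB0).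
  by move=> /eqP; rewrite onee_eq0.
have {b_ge0}b0 : (0 < b)%R by rewrite lt_neqAle eq_sym b0.
rewrite lne_EFin//.
have rho_int : m.-integrable B (EFin \o rho).
  apply/integrableP; split; first exact: measurable_funTS.
  under eq_integral do rewrite /= ger0_norm//.
  by rewrite -rhoE// muB ltry.
have cst_int : m.-integrable B (fun=> (b^-1)%:E).
  apply/integrableP; split; first exact: measurable_cst.
  by rewrite integral_cst//= mBE -EFinM ltry.
have g1_int := integrableZl mB (1 - ln b) rho_int.
have g_int : m.-integrable B (fun x => ((1 - ln b) * rho x - b^-1)%:E).
  exact: (integrableB mB g1_int cst_int).
have muNB : mu (~` B) = 0 by rewrite probability_setC// muB subee.
(* [mu] does not charge the complement of [B], so [rho] vanishes almost everywhere there, and the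
   factor 0 kills the logarithm. *)
have B0 : \int[m]_(x in ~` B) (rho x * ln (rho x))%:E = 0.
  rewrite (@ae_eq_integral _ _ _ m (~` B) (cst 0)) ?integral0//.
  - exact: measurableC.
  - exact/measurable_funTS/(measurable_int _ Fint).
  have : \int[m]_(x in ~` B) `|(rho x)%:E| = 0.
    under eq_integral do rewrite /= ger0_norm//.
    by rewrite -rhoE//; exact: measurableC.
  move/(ae_eq_integral_abs _ (measurableC mB) _).1 => ae0.
  apply: filterS (ae0 (measurable_funTS mrhoE)) => x /= r0 /r0[->].
  by rewrite mul0r.
rewrite -(setUv B) integral_setU; last 4 first.
- exact: mB.
- exact: measurableC.
- exact/measurable_funTS/(measurable_int _ Fint).
- by rewrite disj_set2E setICr.
rewrite B0 adde0.
apply: (@le_trans _ _ (\int[m]_(x in B) ((1 - ln b) * rho x - b^-1)%:E)).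
  rewrite (integralB_EFin mB g1_int cst_int) (integralZl mB rho_int).
  rewrite -rhoE// muB integral_cst//= mBE mule1 -EFinM mulVf ?gt_eqF// -EFinB.
  by rewrite lee_fin; lra.
apply: le_integral => //.
  exact: integrableS Fint.
by move=> x _; rewrite lee_fin mul_ln_ge_tangent.
Qed.

End entropy_estimates.

(** * Contraction of subsets of annuli under MCP *)

Section contraction_towards_a_point.
Context {R : realType} {d : measure_display} {X : polishMetricType R d}.
Implicit Types (m : {measure set X -> \bar R}) (mu : probability X R).

Definition uniform_on m (A : set X) mu := forall U, measurable U ->
  mu U = ((fine (m A))^-1)%:E * m (U `&` A).

Lemma exists_uniform_on m (A : set X) : measurable A -> 0 < m A < +oo ->
  exists mu, uniform_on m A mu.
Proof.
(* [\d_point] is the default of [mnormalize] for mass 0 or [+oo], both excluded here. *)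
move=> mA /andP[A0 Aoo]; exists (mnormalize (mrestr m mA) \d_point) => U mU.
rewrite -[LHS]/(mnormalize (mrestr m mA) \d_point U) /mnormalize /=.
have -> : mrestr m mA setT = m A by congr (m _); exact: setTI.
by rewrite (gt_eqF A0) (lt_eqF Aoo) muleC.
Qed.

Lemma uniform_on1 m (A B : set X) mu : uniform_on m A mu -> 0 < m A < +oo ->
  measurable B -> A `<=` B -> mu B = 1.
Proof.
move=> muE /andP[A0 Aoo] mB AB; rewrite muE// setIidr//.
have Afin : m A \is a fin_num by rewrite ge0_fin_numE// ltW.
rewrite -{2}(fineK Afin) -EFinM mulVf// gt_eqF// fine_gt0//.
by rewrite A0.
Qed.

Lemma uniform_on0 m (A B : set X) mu : uniform_on m A mu ->
  measurable B -> B `&` A = set0 -> mu B = 0.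
Proof. by move=> muE mB BA0; rewrite muE// BA0 measure0 mule0. Qed.

Lemma density_uniform_on m (A : set X) mu : measurable A ->
  0 < m A < +oo -> uniform_on m A mu ->
  density m mu (fun x => (fine (m A))^-1 * \1_A x)%R.
Proof.
move=> mA /andP[A0 Aoo] muE; have c0 : (0 < (fine (m A))^-1)%R.
  by rewrite invr_gt0 fine_gt0// A0.
split.
- exact: measurable_funM.
- by move=> x; rewrite mulr_ge0// ltW.
- move=> U mU; rewrite muE//.
  under eq_integral do rewrite EFinM.
  rewrite ge0_integralZl_EFin ?integral_indic 1?setIC// ?ltW//.
    exact/measurable_EFinP.
Qed.

(** The normalised indicator of [A] belongs to the set under the infimum and bounds the entropy
    above; [entropy_ge] with [B = A] bounds it below by the same value. *)
Lemma entropy_uniform_on m (A : set X) mu : measurable A ->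
  0 < m A < +oo -> uniform_on m A mu -> finite_second_moment mu ->
  entropy m mu = (- ln (fine (m A)))%:E.
Proof.
move=> mA A0oo muE mu2; have /andP[A0 Aoo] := A0oo.
have Afin : m A \is a fin_num by rewrite ge0_fin_numE// ltW.
set c := fine (m A); have mAE : m A = c%:E by rewrite fineK.
have c0 : (0 < c)%R by rewrite fine_gt0// A0.
have lneA : lne (m A) = (ln c)%:E by rewrite mAE lne_EFin.
apply/eqP; rewrite eq_le; apply/andP; split; last first.
  have := entropy_ge m mA (uniform_on1 muE A0oo mA (@subset_refl _ _)).
  by rewrite lneA -EFinN.
have FE x : ((c^-1 * \1_A x) * ln (c^-1 * \1_A x))%R%:E =
    (- (ln c / c))%R%:E * (\1_A x)%:E.
  rewrite indicE; case: (x \in A); last by rewrite !mulr0 mul0r mule0.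
  by rewrite !mulr1 mule1 lnV ?posrE// mulrN mulrC.
have iA : m.-integrable setT (fun x => (\1_A x)%:E).
  apply/integrableP; split; first exact/measurable_EFinP.
  under eq_integral do rewrite /= ger0_norm//.
  by rewrite integral_indic// setIT.
apply: ge_ereal_inf.
exists (\int[m]_x ((c^-1 * \1_A x) * ln (c^-1 * \1_A x))%R%:E).
  exists (fun x => c^-1 * \1_A x)%R => //; split => //.
    exact: density_uniform_on.
  by apply: eq_integrable (integrableZl measurableT (- (ln c / c))%R iA).
under eq_integral do rewrite FE.
rewrite integralZl// integral_indic// setIT mAE -EFinM lee_fin.
by rewrite mulNr divfK// gt_eqF.
Qed.

(** The radius [a > 0] keeps [x0] outside the support of the uniform measure on [A], and [b] makes
    that support bounded, as MCP requires. The slack [e] is that of [W2_geodesic_dirac_annulus]. *)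
Lemma MCP_annulus m (G : X * X -> \bar R) (beta : R -> \bar R -> \bar R)
    (x0 : X) (A : set X) (a b k t e : R) :
  MCP m G beta -> msupport m x0 ->
  measurable A -> m A < +oo -> (0 < a)%R ->
  (forall x, A x -> (a <= mdist x0 x <= b)%R) ->
  (0 < k)%R -> (forall x, A x -> k%:E <= beta t (G (x0, x))) ->
  (0 < t < 1)%R -> (0 < e)%R ->
  k%:E * m A <= m [set x | (t * a - e <= mdist x0 x <= t * b + e)%R].
Proof.
move=> [n n1 mcp] x0m mA Aoo a0 Aab k0 Ak t01 e0.
set B := [set x | _].
have mB : measurable B by exact: measurable_annulus.
have [->|A0] := eqVneq (m A) 0; first by rewrite mule0.
have A0oo : 0 < m A < +oo by rewrite lt_neqAle eq_sym A0/= measure_ge0.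
have [mu1 mu1E] := exists_uniform_on mA A0oo.
have mu1A : mu1 A = 1 by exact: uniform_on1 A0oo mA _.
have mu2 : finite_second_moment mu1.
  exists x0; apply: (integral_sqr_mdist_lty mA mu1A (b := b)) => x Ax.
  by have /andP[] := Aab x Ax.
have entE := entropy_uniform_on mA A0oo mu1E mu2.
have pbs : Pbs_star m mu1.
  split; last by rewrite entE.
    (* The points at distance greater than [b] form an open set that [mu1] does not charge; [b + 1]
       is there because balls are open. *)
    exists x0, (b + 1)%R => x; rewrite ballEmdist /= ltNge => xm.
    apply/negP => xb.
    have oU := open_mdist_gt x0 b.
    have /xm : open_nbhs x [set y | (b < mdist x0 y)%R].
      by split => //=; rewrite (lt_le_trans _ xb)// ltrDl.
    rewrite (uniform_on0 mu1E) ?ltxx//; first exact: open_measurable_polish.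
    by apply/seteqP; split => y //= [yb /Aab/andP[_]]; rewrite leNgt yb.
  (* An open set charged by [mu1] is charged by [m]. *)
  move=> x xm U [oU Ux]; have := xm U (conj oU Ux).
  have mU := open_measurable_polish oU.
  rewrite mu1E// => mUA; rewrite lt_neqAle measure_ge0 andbT eq_sym.
  apply: contraTneq mUA => U0.
  rewrite (subset_measure0 _ _ (@subIsetl _ U A) U0) ?mule0 ?ltxx//.
  exact: measurableI.
have x0mu1 : ~ msupport mu1 x0.
  have oU := open_mdist_lt x0 a.
  have x0U : open_nbhs x0 [set y | (mdist x0 y < a)%R].
    by split => //=; rewrite mdistxx.
  move=> /(_ _ x0U); rewrite (uniform_on0 mu1E) ?ltxx//.
    exact: open_measurable_polish.
  by apply/seteqP; split => y //= [ya /Aab/andP[]]; rewrite leNgt ya.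
have [mu_ [geo mu0E mu_1E ineq]] := mcp x0 mu1 x0m pbs x0mu1.
have mutB : mu_ t B = 1.
  apply: (W2_geodesic_dirac_annulus geo mu0E _ t01 e0).
  rewrite mu_1E; last exact: measurable_annulus.
  exact: uniform_on1 A0oo (measurable_annulus _ _ _) Aab.
have ent_t := entropy_ge m mB mutB.
have n0 : (0 < n^-1)%R by rewrite invr_gt0 (lt_le_trans _ n1).
have Afin : m A \is a fin_num by rewrite ge0_fin_numE.
have c0 : (0 < fine (m A))%R by rewrite fine_gt0.
have intk : (ln k)%:E <= \int[mu1]_x lne (beta t (G (x0, x))).
  apply: (integral_ge_cst mA mu1A) => x /Ak kx.
  rewrite -lne_EFin// lee_lne// in_itv/= leey ?andbT ?lee_fin ?ltW//.
  by rewrite (lt_le_trans _ kx).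
(* This reads [k^(1/n) m(A)^(1/n) <= m(B)^(1/n)], from [intk], the MCP inequality and [ent_t]. The
   common exponent is then removed by monotonicity. *)
have : expeR ((n^-1)%:E * (ln k)%:E) * expeR ((n^-1)%:E * (ln (fine (m A)))%:E)
    <= expeR ((n^-1)%:E * lne (m B)).
  apply: le_trans (le_trans (ineq t t01) _).
    rewrite /entropy_power entE EFinN muleN oppeK.
    apply: lee_wpmul2r; first exact: expeR_ge0.
    by rewrite lee_expeR lee_pmul2l// lte_fin.
  rewrite /entropy_power lee_expeR leeNl -muleN lee_pmul2l// lte_fin//.
rewrite -expeRD lee_expeR -muleDr// lee_pmul2l// -EFinD -lnM ?posrE//.
rewrite -lne_EFin ?mulr_gt0// lee_lne ?in_itv/= ?leey ?measure_ge0 ?lee_fin//.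
  by rewrite EFinM fineK.
by rewrite mulr_ge0// ltW.
Qed.

End contraction_towards_a_point.

(** * Estimates on punctured and full balls *)

(** For the zero measure every essential supremum is [-oo]; a point of [S] in the support of [m]
    rules this case out. *)
Lemma gdiam_ge0 (R : realType) (d : measure_display) (X : polishMetricType R d)
    (m : {measure set X -> \bar R}) (G : X * X -> \bar R) (S : set X) :
  (forall p, 0 <= G p) -> S `<=` msupport m -> S !=set0 -> 0 <= gdiam m G S.
Proof.
move=> G0 Sm [x Sx].
apply: le_ereal_sup_tmp; eexists; first by exists x.
apply: le_ereal_inf_tmp => y /= [N [mN N0 Ny]].
rewrite leNgt; apply/negP => y0.
have : 0 < m setT by apply: (Sm _ Sx); split => //; exact: openT.
suff -> : setT = N by rewrite N0 ltxx.
apply/seteqP; split => // z _; apply: Ny => /= /le_lt_trans/(_ y0).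
rewrite /patch; case: ifP => _; last by rewrite ltxx.
by rewrite ltNge G0.
Qed.

Lemma MCP_ball_sub_point (R : realType) (d : measure_display)
    (X : polishMetricType R d) (m : {measure set X -> \bar R})
    (G : X * X -> \bar R) (beta : R -> \bar R -> \bar R) (S : set X)
    (t k r : R) (x0 : X) :
  finite_on_bounded m -> (forall p, 0 <= G p) -> MCP m G beta ->
  measurable S -> S `<=` msupport m -> (0 < t < 1)%R -> (0 < k)%R ->
  (forall th, 0 <= th <= gdiam m G S -> k%:E <= beta t th) -> S x0 ->
  m ((ball x0 r `&` S) `\ x0) <= (k^-1)%:E * m (ball x0 (t * r)%R `\ x0).
Proof.
move=> m_fin G0 mcp mS Sm /[dup] t01 /andP[t0 t1] k0 betak Sx0.
(* Off the null set [N], [G (x0, y)] is at most the diameter for [y] in [S] other than [x0].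
   Removing [N] from the annuli makes the bound on [beta] hold pointwise. *)
have [N [mN N0 Nsup]] := ess_sup_ge m ((fun y => G (x0, y)) \_ (S `\ x0)).
have Gdiam x : S x -> x <> x0 -> ~ N x -> G (x0, x) <= gdiam m G S.
  move=> Sx xx0 Nx; apply: (@le_trans _ _
    (ess_sup m ((fun y => G (x0, y)) \_ (S `\ x0)))).
    have /contrapT := contra_not (Nsup x) Nx.
    by rewrite /= {1}/patch mem_set.
  by apply: ereal_sup_ubound; exists x0.
have mball s : measurable (ball x0 s).
  by rewrite ballEmdist; exact/open_measurable_polish/open_mdist_lt.
pose h n : R := (n.+1%:R^-1)%R.
have h0 n : (0 < h n)%R by rewrite invr_gt0.
pose A n := (S `&` [set x | (h n <= mdist x0 x <= r - h n)%R]) `\` N.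
have mA n : measurable (A n).
  apply: measurableD => //; apply: measurableI => //.
  exact: measurable_annulus.
have Abound n : m (A n) <= (k^-1)%:E * m (ball x0 (t * r)%R `\ x0).
  (* With slack [t * h n / 2] the dilated annulus has positive inner radius and outer radius below
     [t * r], so it avoids [x0] and stays in the ball. *)
  rewrite lee_pdivlMl//; apply: le_trans (MCP_annulus (beta := beta) (G := G)
      (x0 := x0) (a := h n) (b := (r - h n)%R) (t := t) (e := (t * h n / 2)%R)
      mcp (Sm _ Sx0) (mA n) _ (h0 n) _ k0 _ t01 _) _.
  - apply: m_fin => //; exists x0, r => x [[_ /= /andP[_ xr]] _].
    by rewrite ballEmdist /= (le_lt_trans xr)// ltrBlDr ltrDl.
  - by move=> x [[]].
  - move=> x [[Sx /= /andP[hx _]] Nx]; apply: betak; rewrite G0/= Gdiam//.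
    by move=> xx0; move: hx; rewrite xx0 mdistxx leNgt h0.
  - by rewrite divr_gt0// mulr_gt0.
  have th0 : (0 < t * h n)%R by rewrite mulr_gt0.
  apply: le_measure; rewrite ?inE; first exact: measurable_annulus.
    by apply: measurableD => //; exact: measurable_point.
  move=> x /= /andP[xl xr]; split.
    rewrite ballEmdist /=; move: xr th0; rewrite mulrBr; lra.
  by move=> xx0; move: xl; rewrite xx0 mdistxx; lra.
have Aincr : nondecreasing_seq A.
  move=> n p np; apply/subsetPset => x [[Sx /= /andP[xl xr]] Nx]; split => //.
  have hnp : (h p <= h n)%R by rewrite lef_pV2 ?posrE// ler_nat.
  by split => //=; apply/andP; split; lra.
have Acvg := nondecreasing_cvg_mu (mu := m) mA (bigcupT_measurable A mA) Aincr.
have : m (\bigcup_n A n) <= (k^-1)%:E * m (ball x0 (t * r)%R `\ x0).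
  rewrite -(cvg_lim _ Acvg)//; apply: lime_le; first by apply: cvgP Acvg.
  exact: nearW.
apply: le_trans.
(* The sets [A n] cover the punctured ball in [S] up to [N]: a point enters [A n] once [h n] is
   below both its distance to [x0] and [r] minus that distance. *)
rewrite -[leRHS]adde0 -N0; apply: le_trans (measureU2 _ _ _) => //.
  apply: le_measure; rewrite ?inE.
  - by apply: measurableD; [exact: measurableI|exact: measurable_point].
  - by apply: measurableU => //; exact: bigcupT_measurable.
  move=> x [[]]; rewrite ballEmdist /= => xr Sx xx0.
  have [Nx|Nx] := pselect (N x); [by right|left].
  have x00 : (0 < mdist x0 x)%R by rewrite mdist_gt0 eq_sym; apply/eqP.
  have e0 : (0 < Num.min (mdist x0 x) (r - mdist x0 x))%R.
    by rewrite lt_min x00 subr_gt0.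
  have [n _ /(_ _ (leqnn _))] := near_infty_natSinv_lt (PosNum e0).
  rewrite /= lt_min => /andP[n1 n2]; exists n => //; split => //; split => //=.
  by rewrite (ltW n1)/= lerBrDr addrC -lerBrDr ltW.
exact: bigcupT_measurable.
Qed.

Theorem proposition4p13 (R : realType) (d : measure_display)
    (X : polishMetricType R d) (m : {measure set X -> \bar R})
    (G : X * X -> \bar R) (s : R -> R) (N : R)
    (m_fin : finite_on_bounded m) (G_gauge : gauge G)
    (s_prof : distortion_profile s N)
    (mcp : MCP m G (distortion s N))
    (S : set X) (S_borel : measurable S) (S_supp : S `<=` msupport m)
    (S_bnd : gbounded m G S) (t : R) (t01 : (0 < t < 1)%R) :
  exists C : R,
    [/\ (0 < C)%R,
        (forall (r : R) (x0 : X), (0 <= r)%R -> S x0 ->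
           m (ball x0 r `&` S) <= C%:E * m (ball x0 (t * r)%R)),
        (C^-1)%:E = ereal_inf [set distortion s N t th |
                       th in [set th | 0 <= th <= gdiam m G S]] &
        (0 < C^-1 <= t `^ N)%R].
Proof.
have [t0 t1] := andP t01; have [G0 _] := G_gauge; have [S0 diamoo] := S_bnd.
have diam0 := gdiam_ge0 G0 S_supp S0.
have diamfin : gdiam m G S \is a fin_num by rewrite ge0_fin_numE.
have [k k0 kbeta] := distortion_lb (fine (gdiam m G S)) s_prof t01.
rewrite fineK// in kbeta.
set E := [set distortion s N t th | th in _].
have kE : k%:E <= ereal_inf E.
  by apply: le_ereal_inf_tmp => _ [th /= /andP[th0 thd] <-]; exact: kbeta.
have Et : ereal_inf E <= (t `^ N)%:E.
  apply: ereal_inf_lbound; exists 0; first by rewrite /= lexx.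
  by rewrite /distortion eqxx.
(* Lying between [k > 0] and [t^N], the infimum is a positive real [i]; the constant is [1 / i]. *)
case EE : (ereal_inf E) kE Et => [i| |]//; rewrite !lee_fin => ki it.
have i0 : (0 < i)%R by exact: lt_le_trans ki.
exists i^-1%R; split; rewrite ?invrK ?invr_gt0// ?i0//.
move=> r x0; rewrite le_eqVlt => /predU1P[<- _|r0 Sx0].
  rewrite (_ : ball x0 0 = set0).
    by rewrite set0I measure0 mule_ge0// lee_fin invr_ge0 ltW.
  by rewrite ballEmdist; apply/seteqP; split => y //=; rewrite ltNge mdist_ge0.
have mball u : measurable (ball x0 u).
  by rewrite ballEmdist; exact/open_measurable_polish/open_mdist_lt.
have mx0 := measurable_point x0.
have center u : (0 < u)%R -> ball x0 u x0.
  by move=> u0; rewrite ballEmdist /= mdistxx.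
have splitx0 (B : set X) : measurable B -> B x0 ->
    m B = m (B `\ x0) + m [set x0].
  move=> mB Bx0.
  rewrite -measureU//; [|exact: measurableD|by rewrite setDE -setIA setICl setI0].
  by rewrite setUC setDUK// => _ ->.
(* For [r > 0] both balls contain [x0], so its mass is split off on each side. *)
rewrite (splitx0 (_ `&` S)); last 2 first.
- exact: measurableI.
- by split => //; exact: center.
rewrite (splitx0 (ball x0 (t * r)%R)) ?ge0_muleDr//; last exact/center/mulr_gt0.
apply: leeD.
  (* The infimum [i] is itself an admissible lower bound [k] for [beta_t]. *)
  apply: (MCP_ball_sub_point r m_fin G0 mcp S_borel S_supp t01 i0 _ Sx0).
  by move=> th thd; rewrite -EE; apply: ereal_inf_lbound; exists th.
(* The possible atom at [x0] is absorbed because [i <= t^N <= 1]. *)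
rewrite -[leLHS]mul1e; apply: lee_wpmul2r => //.
rewrite lee_fin invf_ge1//; apply: (le_trans it).
have [N1 _ _] := s_prof; rewrite -(powRr0 t).
by apply: ger_powR; rewrite ?t0 ?(ltW t1)// (le_trans _ N1).
Qed.
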